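(* Let $k\ge 2$ and $0\le l\le k\le n$ be integers. If $T$ is a tree of order $n$ with diameter $d\ge 2$, then $\bar{\varepsilon}_{k,l}(T)\ge \bar{\varepsilon}_{k,l}(T_{n,d}^C)$.
   Context: For a tree $G$ and $S\subseteq V(G)$, $d_G(S)$ is the number of edges of the minimal subtree of $G$ containing $S$. For an $l$-subset $S$ of $V(G)$ ($n=|V(G)|$), $\varepsilon_{k,l}(S;G)=\max\{d_G(S'): S\subseteq S'\subseteq V(G),\ |S'|=k\}$, and $\bar{\varepsilon}_{k,l}(G)=\binom{n}{l}^{-1}\sum_{|S|=l}\varepsilon_{k,l}(S;G)$. Let $u_0u_1\cdots u_d$ be a path. For $d$ even, $T_{n,d}^C$ is obtained by attaching $n-d-1$ new pendant vertices to $u_{d/2}$. For $d$ odd, $T_{n,d}^C(s)$ ($0\le s\le n-d-1$) is obtained by attaching $s$ new pendant vertices to $u_{\lfloor d/2\rfloor}$ and $n-d-1-s$ new pendant vertices to $u_{\lceil d/2\rceil}$; the value $\bar{\varepsilon}_{k,l}(T_{n,d}^C(s))$ does not depend on $s$, and $T_{n,d}^C$ denotes any $T_{n,d}^C(s)$.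
   Formalization: For d odd, l=k and k ≤ n−⌈d/2⌉, the tree T^C_{n,d}(s) is required to have s=0 or s=n−d−1, because the average does depend on s there and the claim fails for other s (n=6, d=3, k=l=2: T^C(0) gives 28/15, T^C(1) gives 29/15). *)

(* Defs.v *)
From mathcomp Require Import all_boot all_order all_algebra.

Set Implicit Arguments.
Unset Strict Implicit.
Unset Printing Implicit Defensive.

Import GRing.Theory Num.Theory.

(* A finite simple graph is a symmetric irreflexive [e : rel V] on a finType;
   a subgraph is a pair [(W, F)] of a vertex set and a set of edges, an edge
   being the two-element set of its endpoints. *)

Section Graphs.

Variable V : finType.
Implicit Types (e f : rel V) (W S : {set V}) (F : {set {set V}}).

Definition edges e : {set {set V}} :=
  [set [set p.1; p.2] | p : V * V & e p.1 p.2].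

Definition edge_rel F : rel V := [rel x y | (x != y) && ([set x; y] \in F)].

(* The length bound only makes the quantification finite; see [acyclicP]. *)
Definition acyclic f : bool :=
  [forall m : 'I_#|V|.+1, [forall c : m.-tuple V,
    (2 < m) ==> ~~ ucycleb f c]].

Lemma acyclicP f :
  reflect (forall c : seq V, 2 < size c -> ~ ucycle f c) (acyclic f).
Proof.
apply: (iffP idP) => [ac c c2 cc | ac].
  have cn : size c < #|V|.+1.
    by rewrite ltnS; case/andP: cc => _ /card_uniqP <-; apply: max_card.
  move/forallP/(_ (Ordinal cn))/forallP/(_ (in_tuple c)): ac.
  by rewrite /= c2 /=; apply/negP; rewrite negbK.
apply/forallP => m; apply/forallP => c; apply/implyP => m2.
by apply/negP => cc; apply: (ac c) => //; rewrite size_tuple.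
Qed.

(* [f] is a tree with vertex set [W]; edges of [f] are meant to lie in [W]. *)
Definition tree_on W f : bool :=
  [&& W != set0, [forall x in W, forall y in W, connect f x y] & acyclic f].

Definition is_tree e : Prop :=
  [/\ symmetric e, irreflexive e & tree_on [set: V] e].

Definition subtree e (H : {set V} * {set {set V}}) : bool :=
  [&& H.2 \subset edges e, [forall E in H.2, E \subset H.1]
    & tree_on H.1 (edge_rel H.2)].

(* When [e] is a tree, [([set: V], edges e)] is itself a subtree containing
   [S], so the default value [#|edges e|] of the minimum is harmless. *)
Definition steiner e S : nat :=
  \big[minn/#|edges e|]_(H | subtree e H && (S \subset H.1)) #|H.2|.

(* Shortest walk length; the default [#|V|] occurs only for disconnected
   [x] and [y]. *)
Definition dist e (x y : V) : nat :=
  \big[minn/#|V|]_(m < #|V| |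
    [exists p : m.-tuple V, path e x p && (last x p == y)]) (m : nat).

Definition diameter e : nat := \max_(x : V) \max_(y : V) dist e x y.

(* The parameter [l] of the eccentricity is the cardinality of [S]. *)
Definition ecc e (k : nat) S : nat :=
  \max_(S' : {set V} | (S \subset S') && (#|S'| == k)) steiner e S'.

Definition avg_ecc e (k l : nat) : rat :=
  (('C(#|V|, l)%:R)^-1 * (\sum_(S : {set V} | #|S| == l) ecc e k S)%:R)%R.

End Graphs.

(* The tree obtained from the path [0 - 1 - ... - d] by attaching the pendant
   vertices [d + 1, ..., d + s] to [floor (d / 2)] and the pendant vertices
   [d + s + 1, ..., n - 1] to [ceil (d / 2)], given as a rooted tree with root
   [0]. For even [d] both attachment points are [d / 2] and [s] plays no role.

   For odd [d], the value of [avg_ecc (TC n d s) k l] does not depend on [s]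
   when [l < k]. When [l = k] it does not either if [k > n - ceil (d / 2)], but
   for [k <= n - ceil (d / 2)] it is minimal exactly at the two extreme values
   [s = 0] and [s = n - d - 1]: a [k]-set avoids the middle edge of the path
   iff it lies within one of the two components left by deleting that edge,
   and the number of such [k]-sets is strictly convex in [s] in that range. *)
Definition TC_parent (d s y : nat) : nat :=
  if y <= d then y.-1 else if y <= d + s then d./2 else uphalf d.

Definition TC (n d s : nat) : rel 'I_n :=
  [rel x y : 'I_n | ((x < y) && (x == TC_parent d s y :> nat))
                 || ((y < x) && (y == TC_parent d s x :> nat))].
Arguments TC : clear implicits.

(* Main.v *)
Require Import Defs.
From mathcomp Require Import all_boot all_order all_algebra.
From mathcomp Require Import zify.

(* The Steiner distance of [S] is the number of edges whose removal splits [S].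
   Let [P] be a diametral path of the tree [T], and label the vertices of [T] so
   that [P] becomes the path [0 - ... - d] of the caterpillar. A set [S] meeting
   [P] has Steiner distance at least the length of the span of its projection to
   [P] plus the number of its vertices off [P], with equality in the caterpillar.

   If [l < k], the eccentricities compare set by set: in a [k]-set [S' = R + x]
   extending [S], with [x] not in [S], the vertex [x] can be exchanged for a
   vertex [y], an end of [P] not in [R] if there is one, such that [R + y] is at
   least as spread out in [T] as [R + x] is in the caterpillar.

   If [l = k], the sum of the Steiner distances is the sum over the edges of the
   number of [k]-sets they split. By convexity of binomial coefficients an edge
   splits the more [k]-sets the more balanced it is, and each edge of [T] is at
   least as balanced as the corresponding edge of the caterpillar. *)

Set Implicit Arguments.
Unset Strict Implicit.
Unset Printing Implicit Defensive.

Lemma bigmin_le (I : eqType) (s : seq I) (m : nat) (P : pred I) (F : I -> nat) i :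
  i \in s -> P i -> \big[minn/m]_(j <- s | P j) F j <= F i.
Proof.
elim: s => // j s IHs; rewrite inE big_cons => /predU1P[<- -> | si Pi].
  exact: geq_minl.
by case: ifP => _; rewrite ?geq_min IHs ?orbT.
Qed.

Lemma bigmin_attained (I : eqType) (s : seq I) (m : nat) (P : pred I) (F : I -> nat) :
  \big[minn/m]_(j <- s | P j) F j = m
  \/ exists2 i, P i & \big[minn/m]_(j <- s | P j) F j = F i.
Proof.
elim: s => [|j s IHs]; first by rewrite big_nil; left.
rewrite big_cons; case: ifP => // Pj; rewrite /minn; case: ltnP => // _.
by right; exists j.
Qed.

(** * Rooted trees: descendants, split edges and Steiner distance *)

Section Rooted.

Variables (V : finType) (e : rel V) (r : V) (par : V -> V) (h : V -> nat).

(* [par] is the parent map and [h] the depth; the value [par r] is junk. *)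
Definition rooted : Prop :=
  [/\ forall x y, e x y = (x != r) && (par x == y) || (y != r) && (par y == x),
      h r = 0 & forall x, x != r -> h x = (h (par x)).+1].

(** The number of steps from [y] up to [x] is forced by the depths, and climbing only that far never
    applies [par] to the root. *)
Definition desc (x : V) : {set V} :=
  [set y | (h x <= h y) && (iter (h y - h x) par y == x)].

(* Nonroot vertices [x] stand for the edges [{x, par x}]. *)
Definition sepset (S : {set V}) : {set V} :=
  [set x | [&& x != r, S :&: desc x != set0 & ~~ (S \subset desc x)]].

Hypothesis tr : rooted.

Let eE : forall x y, e x y = (x != r) && (par x == y) || (y != r) && (par y == x).
Proof. by case: tr. Qed.
Let hr : h r = 0. Proof. by case: tr. Qed.
Let h_par : forall x, x != r -> h x = (h (par x)).+1. Proof. by case: tr. Qed.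

Lemma descE x y : (y \in desc x) = (y == x) || (y != r) && (par y \in desc x).
Proof.
rewrite !inE; have [->|yx] /= := eqVneq y x; first by rewrite leqnn subnn eqxx.
have [E|yr] /= := eqVneq y r.
  by rewrite E hr sub0n /= -E (negPf yx) andbF.
rewrite (h_par yr); case: (ltngtP (h x) (h (par y)).+1) => [lt|gt|eq] /=.
- by rewrite -ltnS lt subSn // iterSr.
- by rewrite leqNgt (ltn_trans _ gt).
- by rewrite eq subnn /= ltnn (negPf yx).
Qed.

Lemma desc_refl x : x \in desc x. Proof. by rewrite descE eqxx. Qed.

Lemma desc_h x y : y \in desc x -> h x <= h y.
Proof. by rewrite inE => /andP[]. Qed.

Lemma desc_trans x y z : z \in desc y -> y \in desc x -> z \in desc x.
Proof.
move=> zy yx; have [m] := ubnP (h z); elim: m z zy => // m IH z.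
rewrite descE => /predU1P[-> //|/andP[zr pz]]; rewrite (h_par zr) ltnS => hz.
by rewrite descE zr (IH _ pz) ?orbT.
Qed.

Lemma desc_par x : x != r -> x \in desc (par x).
Proof. by move=> xr; rewrite descE xr desc_refl orbT. Qed.

Lemma desc_root : desc r = setT.
Proof.
apply/setP=> y; rewrite in_setT; have [m] := ubnP (h y); elim: m y => // m IH y.
rewrite descE; have [//|yr] := eqVneq y r; rewrite (h_par yr) ltnS => hy.
exact: IH.
Qed.

(** Climbing from [z] passes through all its ancestors, so depth orders them linearly. *)
Lemma desc_chain x y z : z \in desc x -> z \in desc y -> h x <= h y -> y \in desc x.
Proof.
rewrite !inE => /andP[_ /eqP zx] /andP[yz /eqP zy] xy; rewrite xy /= -{2}zy -iterD.
by rewrite addnC addnBA // subnK // zx.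
Qed.

(** Two distinct vertices with the same parent edge would be each other's parent, which the depths
    forbid. *)
Lemma par_edge_inj x y : x != r -> y != r ->
  [set x; par x] = [set y; par y] -> x = y.
Proof.
move=> xr yr E; have := set21 x (par x); have := set21 y (par y).
rewrite {1}E -{1}E !inE => /orP[/eqP-> //|/eqP yx] /orP[/eqP-> //|/eqP xy].
by have := h_par xr; have := h_par yr; rewrite -yx -xy; lia.
Qed.

Lemma card_par_edges (A : {set V}) : r \notin A ->
  #|[set [set x; par x] | x in A]| = #|A|.
Proof.
move=> rA; apply: card_in_imset => x y xA yA; apply: par_edge_inj.
  by apply: contraNneq rA => <-.
by apply: contraNneq rA => <-.
Qed.

Lemma root_notin_sepset S : r \notin sepset S.
Proof. by rewrite inE eqxx. Qed.

Lemma edgesP x y : ([set x; y] \in edges e) = e x y.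
Proof.
have sym a b : e a b = e b a by rewrite !eE orbC.
apply/imsetP/idP => [[[a b] ab /= E] | xy]; last by exists (x, y); rewrite ?inE.
have {}ab : e a b by move: ab; rewrite inE.
have irr : a != b.
  apply: contraTneq ab => <-; rewrite eE orbb; apply/negP => /andP[ar /eqP pa].
  by have := h_par ar; rewrite pa; lia.
have := set21 x y; have := set22 x y; rewrite E !inE.
case/orP=> /eqP yE /orP[] /eqP xE; rewrite xE yE ?ab 1?sym //.
- have := set22 a b; rewrite -E !inE xE yE orbb eq_sym => /eqP ba.
  by rewrite ba eqxx in irr.
- have := set21 a b; rewrite -E !inE xE yE orbb => /eqP ba.
  by rewrite ba eqxx in irr.
Qed.

(** A subtree containing [S] uses the parent edge of every [x] in [sepset S]: without it, [desc x]
    would be closed under adjacency in the subtree, yet [S] has points inside and outside. *)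
Lemma sepset_le_steiner S : #|sepset S| <= steiner e S.
Proof.
rewrite -(card_par_edges (root_notin_sepset S)).
have par_edges : [set [set x; par x] | x in sepset S] \subset edges e.
  apply/subsetP=> _ /imsetP[x xS ->]; rewrite edgesP eE eqxx andbT.
  by move: xS; rewrite inE => /and3P[-> _ _].
rewrite /steiner; elim/big_ind: _ => [|a b|[W F]] /=.
- exact: subset_leq_card.
- by rewrite leq_min => -> ->.
move=> /andP[/and3P[/= Fe FW /and3P[_ conn _]] SW].
apply: subset_leq_card; apply/subsetP=> _ /imsetP[x xS ->]; move: xS; rewrite inE.
case/and3P=> xr /set0Pn[a /setIP[aS ax]] /subsetPn[b bS bx].
move/forall_inP: conn => /(_ a (subsetP SW a aS))/forall_inP/(_ b (subsetP SW b bS)) ab.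
apply: contraR bx => xF.
suff cl : closed (edge_rel F) (desc x) by rewrite -(closed_connect cl ab).
move=> y z /= /andP[yz yzF].
have := subsetP Fe _ yzF; rewrite edgesP eE.
have step u v : u != r -> par u = v -> [set u; v] \in F -> (u \in desc x) = (v \in desc x).
  move=> ur <- uF; rewrite (descE x u) ur /=; case: eqP => //= ux.
  by rewrite -ux uF in xF.
case/orP=> /andP[nr /eqP E]; first exact: step.
by rewrite (step z y) // setUC.
Qed.

(** A deepest vertex of a cycle has two distinct neighbours on it, and both would have to be its
    parent. *)
Lemma rooted_acyclic (f : rel V) : subrel f e -> acyclic f.
Proof.
move=> fe; apply/acyclicP => c c2 /andP[cyc uc].
have [x0 x0c] : exists x, x \in c by case: c c2 {cyc uc} => // x; exists x; rewrite inE eqxx.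
case: (arg_maxnP h x0c) => x xc xmax.
have [i c' Ec] := rot_to xc.
have := rot_cycle i f c; have := rot_uniq i c; rewrite Ec cyc uc => uc' /esym/esym cyc'.
have size_c' : 1 < size c' by have := size_rot i c; rewrite Ec /=; lia.
have up y : y \in c -> e x y || e y x -> par x = y.
  move=> yc xy.
  have : (x != r) && (par x == y) || (y != r) && (par y == x).
    by move: xy; rewrite !eE; case/orP=> //; rewrite orbC.
  case/orP=> /andP[nr /eqP E //].
  by have := h_par nr; have := xmax y yc; rewrite E; lia.
have mem y : y \in c' -> y \in c by move=> yc; rewrite -(mem_rot i) Ec inE yc orbT.
case: c' size_c' {Ec} uc' cyc' mem => // y c'; case/lastP: c' => // c' z _ uc' cyc' mem.
move: cyc'; rewrite /= rcons_path last_rcons /= => /and3P[/fe xy _ /fe zx].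
have Ey := up y (mem y (mem_head _ _)).
have Ez := up z (mem z _).
rewrite -Ey ?xy // -Ez ?zx ?orbT // in uc'; last by rewrite inE mem_rcons mem_head orbT.
by move: uc'; rewrite /= mem_rcons mem_head andbF.
Qed.

(** The parent edges of [sepset S], with their endpoints and [S], form a subtree. It is connected
    because every vertex of [W] climbs along these edges to a vertex outside [sepset S], and only
    one such vertex exists. *)
Lemma steiner_le_sepset S : S != set0 -> steiner e S <= #|sepset S|.
Proof.
move=> S0; rewrite -(card_par_edges (root_notin_sepset S)).
set F := [set [set x; par x] | x in sepset S]; set W := S :|: cover F.
have sepP x : x \in sepset S -> [/\ x != r, exists2 a, a \in S & a \in desc x & ~~ (S \subset desc x)].
  by rewrite inE => /and3P[-> /set0Pn[a /setIP[aS ax]] ->]; split=> //; exists a.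
have FE E : E \in F -> exists2 x, x \in sepset S & E = [set x; par x].
  by case/imsetP=> x; exists x.
have FW E : E \in F -> E \subset W.
  by move=> EF; apply: subset_trans (subsetUr _ _); apply: bigcup_sup.
have WP w : w \in W -> [\/ w \in S, w \in sepset S | exists2 x, x \in sepset S & w = par x].
  case/setUP=> [|/bigcupP[E /FE[x xS ->]]]; first by constructor 1.
  by case/set2P=> ->; [constructor 2 | constructor 3; exists x].
have subFe : subrel (edge_rel F) e.
  move=> x y /= /andP[_ /imsetP[z zS E]]; rewrite -edgesP E edgesP eE eqxx andbT.
  by case: (sepP z zS) => ->.
suff tF : subtree e (W, F) && (S \subset W).
  exact: (@bigmin_le _ _ _ _ (fun H : {set V} * {set {set V}} => #|H.2|) _ (mem_index_enum (W, F)) tF).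
rewrite subsetUl andbT; apply/and3P; split=> /=.
- apply/subsetP=> _ /FE[x xS ->]; rewrite edgesP eE eqxx andbT.
  by case: (sepP x xS) => ->.
- by apply/forall_inP=> E /FW.
apply/and3P; split.
- by case/set0Pn: S0 => a aS; apply/set0Pn; exists a; rewrite inE aS.
- have WS w : w \in W -> exists2 a, a \in S & a \in desc w.
    case/WP=> [wS|/sepP[] // |[x /sepP[xr [a aS ax] _] ->]].
      by exists w; rewrite ?desc_refl.
    by exists a => //; apply: desc_trans ax (desc_par xr).
  (* Some point of [S] lies below [t], and the edge above [t] does not split [S]; so all of [S] lies
     below [t]. *)
  have topW t : t \in W -> t \notin sepset S -> S \subset desc t.
    move=> /WS[a aS ta]; rewrite inE; have [->|tr0] := eqVneq t r; first by rewrite desc_root.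
    rewrite /= negb_and !negbK => /orP[/eqP S0'|//].
    have : a \in S :&: desc t by rewrite in_setI aS.
    by rewrite S0' inE.
  have climb w : w \in W -> exists2 t, t \in W /\ t \notin sepset S & connect (edge_rel F) w t.
    have [m] := ubnP (h w); elim: m w => // m IH w hw wW.
    have [wS|] := boolP (w \in sepset S); last by exists w.
    have [wr _ _] := sepP w wS; rewrite (h_par wr) ltnS in hw.
    have wF : [set w; par w] \in F by apply: imset_f.
    have pW : par w \in W by apply: (subsetP (FW _ wF)); rewrite set22.
    have [t tP wt] := IH _ hw pW; exists t => //; apply: connect_trans wt.
    apply: connect1; apply/andP; split=> //.
    by apply/eqP=> E; have := h_par wr; rewrite -E; lia.
  (* Both vertices lie above all of [S], hence on a chain. If [t] were strictly higher, it could be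
     neither in [S] nor in [sepset S], so it would be [par x] for some [x] in [sepset S]; then [x]
     is [t'] or above it, and all of [S] lies below [x], a contradiction. *)
  have top_le t t' : t \in W -> t \notin sepset S -> t' \in W -> t' \notin sepset S ->
      h t <= h t' -> t = t'.
    move=> tW tS t'W t'S; have St := topW t tW tS; have St' := topW t' t'W t'S.
    case/set0Pn: S0 => a aS; have at_ := subsetP St a aS; have at' := subsetP St' a aS.
    move=> hh; have := desc_chain at_ at' hh.
    rewrite inE hh /=; case: (ltngtP (h t) (h t')) hh => // [lt _ | -> _].
      move=> _; exfalso; case/WP: tW => [tS' | tS' | [x xS Et]].
      - by have := desc_h (subsetP St' t tS'); lia.
      - by rewrite tS' in tS.
      - have [xr [b bS bx] /negP[]] := sepP x xS; apply/subsetP => c cS.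
        apply: desc_trans (subsetP St' c cS) _; apply: desc_chain bx (subsetP St' b bS) _.
        by rewrite (h_par xr) -Et.
    by rewrite subnn => /eqP.
  have sym : connect_sym (edge_rel F).
    by apply: sym_connect_sym => x y; rewrite /edge_rel /= eq_sym [[set x; y]]setUC.
  apply/forall_inP=> x xW; apply/forall_inP=> y yW.
  have [t [tW tS] xt] := climb x xW; have [t' [t'W t'S] yt'] := climb y yW.
  have E : t = t' by case: (leqP (h t) (h t')) => [|/ltnW] /top_le-> //.
  by apply: connect_trans xt _; rewrite sym E.
- exact: rooted_acyclic.
Qed.

End Rooted.

(** * Distances and breadth-first rooting *)

Lemma diameter_attained (V : finType) (e : rel V) : 0 < #|V| ->
  exists x y, dist e x y = diameter e.
Proof.
move=> V0; rewrite /diameter.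
have [x ->] := eq_bigmax (fun x => \max_y dist e x y) V0.
by have [y ->] := eq_bigmax (dist e x) V0; exists x, y.
Qed.

Section BreadthFirst.

Variables (V : finType) (e : rel V) (r : V).

Lemma dist_le_path p : path e r p -> dist e r (last r p) <= size p.
Proof.
have short q : path e r q -> size q < #|V| -> dist e r (last r q) <= size q.
  move=> eq sq.
  apply: (@bigmin_le _ _ _ _ (@nat_of_ord #|V|) _ (mem_index_enum (Ordinal sq))).
  by apply/existsP; exists (in_tuple q); rewrite /= eq eqxx.
move=> ep; case: (ltnP (size p) #|V|) => [|le]; first exact: short.
case/shortenP: ep => q eq uq _.
have sq : size q < #|V| by have := max_card (mem (r :: q)); rewrite (card_uniqP uq).
by apply: leq_trans (short q eq sq) _; apply: leq_trans (ltnW sq) le.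
Qed.

Lemma dist_path x : connect e r x ->
  exists p, [/\ path e r p, last r p = x & size p = dist e r x].
Proof.
case/connectP=> p0 /shortenP[p ep up _] ->.
(* A simple path has fewer than [#|V|] edges, so [dist] is below its default value and is attained
   by a walk. *)
have sp : size p < #|V| by have := max_card (mem (r :: p)); rewrite (card_uniqP up).
have := dist_le_path ep; rewrite /dist.
case: (bigmin_attained (index_enum 'I_#|V|) #|V| (fun m : 'I_#|V| =>
  [exists q : m.-tuple V, path e r q && (last r q == last r p)]) (fun m => m : nat)).
  by move=> ->; rewrite leqNgt sp.
by case=> m /existsP[q /andP[eq /eqP lq]] -> _; exists q; rewrite size_tuple.
Qed.

(* If [e x y] were not a parent edge, the parent edges would still join [x] and
   [y] through the root, and [{x, y}] would close a cycle. *)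
Lemma tree_rooted : is_tree e -> exists par, rooted e r par (dist e r).
Proof.
case=> sym irr /and3P[_ conn /acyclicP acyc].
have conn_r x : connect e r x.
  by move/forall_inP: conn => /(_ r (in_setT _))/forall_inP/(_ x (in_setT _)).
pose h := dist e r; pose par x := odflt r [pick y | e y x && (h x == (h y).+1)].
have h_r : h r = 0 by apply/eqP; rewrite -leqn0; apply: (@dist_le_path [::]).
have parP x : x != r -> e (par x) x /\ h x = (h (par x)).+1.
  move=> xr; rewrite /par; case: pickP => [y /andP[yx /eqP] //|nox].
  (* The last but one vertex of a shortest path to [x] is a neighbour one step closer to [r]. *)
  have [p [ep lp sp]] := dist_path (conn_r x).
  case/lastP: p => [|p z] in ep lp sp; first by rewrite -lp eqxx in xr.
  rewrite last_rcons in lp; rewrite lp rcons_path in ep; case/andP: ep => ep px.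
  rewrite size_rcons in sp.
  have le_py := dist_le_path ep.
  have [q [eq lq sq]] := dist_path (conn_r (last r p)).
  have := @dist_le_path (rcons q x); rewrite rcons_path last_rcons size_rcons eq lq px.
  move=> /(_ isT) le_x; have := nox (last r p); rewrite px /= /h => /negP[].
  by apply/eqP; lia.
exists par; split=> // [x y|x /parP[] //].
apply/idP/idP => [xy | /orP[] /andP[nr /eqP<-]]; last 2 first.
- by rewrite sym; case: (parP x nr).
- by case: (parP y nr).
apply: contraT => /norP[]; rewrite !negb_and !negbK => px py.
pose f := [rel a b | e a b && ([set a; b] != [set x; y])].
have symf : connect_sym f.
  by apply: sym_connect_sym => a b /=; rewrite sym [[set a; b]]setUC.
have fr z : connect f z r.
  have [m] := ubnP (h z); elim: m z => // m IH z hz.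
  have [->|zr] := eqVneq z r; first exact: connect0.
  have [ez hpz] := parP z zr; apply: connect_trans (IH (par z) _); last by lia.
  apply: connect1; rewrite /= sym ez; apply/eqP=> E.
  have neq : par z != z by apply: contraTneq ez => ->; rewrite irr.
  have : z \in [set x; y] by rewrite -E set21.
  have : par z \in [set x; y] by rewrite -E set22.
  rewrite !inE => /orP[] /eqP pzE /orP[] /eqP zE; try by rewrite pzE zE eqxx in neq.
    by case/orP: py; rewrite -zE ?(negPf zr) // pzE eqxx.
  by case/orP: px; rewrite -zE ?(negPf zr) // pzE eqxx.
have : connect f x y by apply: connect_trans (fr x) _; rewrite symf.
case/connectP=> p0 /shortenP[p fp up _] yp.
have ne : x != y by apply: contraTneq xy => ->; rewrite irr.
(* A simple path from [x] to [y] that avoids their edge has at least two edges, so adding the edge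
   gives a cycle of length at least 3. *)
case: p fp up yp => [_ _ /= E|a [|b p] fp up /= yp]; first by rewrite -E eqxx in ne.
  by move: fp; rewrite /= -yp eqxx andbF.
case: (acyc [:: x, a, b & p]) => //; apply/andP; split=> //.
rewrite /cycle rcons_path; apply/andP; split; last by rewrite /= -yp sym.
by apply: sub_path fp => ? ? /andP[].
Qed.

End BreadthFirst.

(** * Projection to a path descending from the root *)

Section Spine.

Variables (V : finType) (e : rel V) (r : V) (par : V -> V) (h : V -> nat).
Hypothesis tr : rooted e r par h.
Variables (t : V) (d : nat).
Hypothesis ht : h t = d.

(** Indexed by depth: [spine 0] is the root and [spine d] is [t]. *)
Definition spine (i : nat) : V := iter (d - i) par t.

(* The index of the vertex of the path from [r] to [t] that is closest to [v]. *)
Definition proj (v : V) : nat := \max_(i < d.+1 | v \in desc par h (spine i)) i.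

Definition off_spine (S : {set V}) : {set V} :=
  S :\: [set spine i | i : 'I_d.+1].

Lemma h_spine i : i <= d -> h (spine i) = i.
Proof.
case: tr => _ hr h_par.
have iter_h j : j <= d -> h (iter j par t) = d - j.
  elim: j => [|j IHj] jd; first by rewrite subn0.
  have {IHj} hj := IHj (ltnW jd).
  have nr : iter j par t != r by apply: contraTneq jd => E; rewrite E hr in hj; lia.
  by have := h_par _ nr; rewrite hj /=; lia.
by move=> id; rewrite iter_h ?leq_subr // subKn.
Qed.

Lemma spine_inj i j : i <= d -> j <= d -> spine i = spine j -> i = j.
Proof. by move=> id jd E; rewrite -(h_spine id) E h_spine. Qed.

Lemma spine_desc i j : i <= j -> j <= d -> spine j \in desc par h (spine i).
Proof.
move=> ij jd; rewrite inE (h_spine jd) (h_spine (leq_trans ij jd)) ij /= -iterD.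
by rewrite (_ : j - i + (d - j) = d - i) //; lia.
Qed.

Lemma spine0 : spine 0 = r.
Proof.
case: tr => _ _ h_par; apply/eqP; apply: contraT => nr.
by have := h_par _ nr; rewrite h_spine.
Qed.

Lemma proj_le v : proj v <= d.
Proof. by apply/bigmax_leqP => i _; rewrite -ltnS. Qed.

(** The spine vertices above [v] form an initial segment of the spine, nonempty because it contains
    the root. *)
Lemma le_proj i v : i <= d -> (i <= proj v) = (v \in desc par h (spine i)).
Proof.
move=> id; apply/idP/idP => [|vi].
  have [j vj ->] : {j : 'I_d.+1 | v \in desc par h (spine j) & proj v = j}.
    apply: eq_bigmax_cond; apply/card_gt0P; exists ord0.
    by change (v \in desc par h (spine 0)); rewrite spine0 (desc_root tr) inE.
  move=> ij; apply: (desc_trans tr vj); apply: spine_desc => //; by rewrite -ltnS.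
have id' : i < d.+1 by [].
exact: (leq_bigmax_cond (Ordinal id') vi).
Qed.

Lemma proj_spine i : i <= d -> proj (spine i) = i.
Proof.
move=> id; apply/eqP; rewrite eqn_leq le_proj // (desc_refl tr) andbT.
have := leqnn (proj (spine i)); rewrite {1}le_proj ?proj_le // => /desc_h.
by rewrite !h_spine ?proj_le.
Qed.

Lemma spine_segment_card i m : i + m <= d.+1 ->
  #|[set spine (i + j) | j : 'I_m]| = m.
Proof.
move=> im; rewrite card_imset ?card_ord // => a b E; apply/ord_inj.
have := ltn_ord a; have := ltn_ord b => bm am.
by apply/(@addnI i)/spine_inj; rewrite ?E //; lia.
Qed.

(** Two disjoint families of edges split [S]: the spine edges between the projections of [y] and
    [x], and the parent edges of the off-spine vertices [v] of [S], each separating [v] from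
    [spine i] because no spine vertex lies below [v]. *)
Lemma card_sepset_ge (S : {set V}) x y i :
  x \in S -> y \in S -> i <= d -> spine i \in S ->
  (proj x - proj y) + #|off_spine S| <= #|sepset r par h S|.
Proof.
move=> xS yS id iS; have px := proj_le x; have py := proj_le y.
set A := [set spine ((proj y).+1 + j) | j : 'I_(proj x - proj y)].
have cardA : #|A| = proj x - proj y.
  by rewrite spine_segment_card //; lia.
have root_spine j : j <= d -> (spine j == r) = (j == 0).
  move=> jd; rewrite -spine0; apply/eqP/eqP => [|->] //.
  exact: spine_inj.
have disj : [disjoint A & off_spine S].
  apply/pred0Pn => -[_ /andP[/imsetP[j _ ->]]]; rewrite !inE => /andP[/imsetP[]].
  have jd : (proj y).+1 + j < d.+1 by have := ltn_ord j; lia.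
  by exists (Ordinal jd).
move: disj; rewrite -(leq_card_setU A (off_spine S)) cardA => /eqP <-.
apply: subset_leq_card; apply/subsetP => v /setUP[/imsetP[j _ ->]|].
  have jd : (proj y).+1 + j <= proj x by have := ltn_ord j; lia.
  have jd' := leq_trans jd px.
  rewrite inE root_spine //=; apply/andP; split.
    by apply/set0Pn; exists x; rewrite inE xS -le_proj.
  by apply/subsetPn; exists y; rewrite // -le_proj //; lia.
rewrite !inE => /andP[/imsetP vP vS].
have notspine j : j <= d -> v <> spine j.
  by rewrite -ltnS => jd E; apply: vP; exists (Ordinal jd).
apply/and3P; split.
- by apply/eqP => E; apply: (notspine 0); rewrite ?spine0.
- by apply/set0Pn; exists v; rewrite inE vS (desc_refl tr).
apply/subsetPn; exists (spine i) => //; rewrite inE h_spine //.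
apply/negP => /andP[vi /eqP E]; apply: (notspine (h v)); first exact: leq_trans vi id.
by rewrite -{1}E /spine -iterD; congr iter; lia.
Qed.

(** Together with the next lemma, this bounds how unbalanced a spine edge can be: the spine itself
    contributes vertices to both sides. *)
Lemma card_desc_spine_ge i : i <= d -> d - i < #|desc par h (spine i)|.
Proof.
move=> id; rewrite -[_.+1](@spine_segment_card i); last by lia.
apply: subset_leq_card; apply/subsetP => _ /imsetP[j _ ->]; apply: spine_desc; first exact: leq_addr.
by have := ltn_ord j; lia.
Qed.

Lemma card_desc_spineC_ge i : i <= d -> i <= #|~: desc par h (spine i)|.
Proof.
move=> id; rewrite -[leqLHS](@spine_segment_card 0); last by lia.
apply: subset_leq_card; apply/subsetP => _ /imsetP[j _ ->]; rewrite inE -le_proj // add0n.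
by have ji := ltn_ord j; rewrite proj_spine; lia.
Qed.

Lemma proj_par v : v \notin [set spine i | i : 'I_d.+1] -> proj v = proj (par v).
Proof.
move=> /imsetP vP.
have vs i : i <= d -> v != spine i.
  by rewrite -ltnS => id; apply/eqP=> E; apply: vP; exists (Ordinal id).
have vr : v != r by rewrite -spine0 vs.
have E i : i <= d -> (i <= proj v) = (i <= proj (par v)).
  by move=> id; rewrite !le_proj // (descE tr) vr (negPf (vs i id)).
have Pd w : proj w <= d by apply: proj_le.
by apply/eqP; rewrite eqn_leq -(E _ (Pd v)) leqnn (E _ (Pd (par v))) leqnn.
Qed.

(** When off-spine vertices have no children, an edge splitting [S] is either a spine edge between
    the indices [a] and [b] or the parent edge of an off-spine vertex of [S]. *)
Lemma card_sepset_le (S : {set V}) a b :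
  (forall v, v \notin [set spine i | i : 'I_d.+1] -> desc par h v = [set v]) ->
  (forall x, x \in S -> a <= proj x <= b) ->
  #|sepset r par h S| <= (b - a) + #|off_spine S|.
Proof.
move=> leaf Sab; set A := [set spine (a.+1 + j) | j : 'I_(b - a)].
have cA : #|A| <= b - a by rewrite -[leqRHS]card_ord leq_imset_card.
apply: leq_trans (leq_add cA (leqnn _)); apply: leq_trans (leq_card_setU _ _).
apply: subset_leq_card; apply/subsetP => v; rewrite inE.
case/and3P=> vr /set0Pn[x /setIP[xS xv]] /subsetPn[y yS yv].
have [vP|vP] := boolP (v \in [set spine i | i : 'I_d.+1]); last first.
  by move: xv; rewrite (leaf _ vP) inE => /eqP xv; rewrite in_setU in_setD vP -xv xS orbT.
case/imsetP: vP => -[i /= id] _ Ev; rewrite ltnS in id.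
rewrite Ev -!le_proj // in xv yv.
have := Sab x xS; have := Sab y yS => ay xb.
have ib : i - a.+1 < b - a by lia.
rewrite inE; apply/orP; left; apply/imsetP; exists (Ordinal ib) => //=.
by rewrite Ev; congr spine; lia.
Qed.

End Spine.

(** * Counting the sets split by an edge *)

Lemma sum_sepset (V : finType) (r : V) (par : V -> V) (h : V -> nat) k : 0 < k ->
  \sum_(S : {set V} | #|S| == k) #|sepset r par h S|
  + \sum_(x | x != r) ('C(#|desc par h x|, k) + 'C(#|~: desc par h x|, k))
  = #|V|.-1 * 'C(#|V|, k).
Proof.
move=> k0.
have draws (B : {set V}) : 'C(#|B|, k) = \sum_(S : {set V} | #|S| == k) (S \subset B).
  rewrite -cards_draws -sum1dep_card; under eq_bigl do rewrite andbC.
  by rewrite big_mkcondr; apply: eq_bigr => S _; case: ifP.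
have sepE (S : {set V}) : #|sepset r par h S| = \sum_(x | x != r) (x \in sepset r par h S).
  rewrite -sum1_card big_mkcond [RHS]big_mkcond /=; apply: eq_bigr => x _.
  by rewrite !inE; case: eqP => //= _; case: ifP.
rewrite (eq_bigr _ (fun S _ => sepE S)).
(* For each nonroot [x], a [k]-set is split by the edge of [x], lies in [desc x], or lies outside
   it; the last two exclude each other because [k > 0]. *)
rewrite exchange_big -big_split /= -[in #|V|.-1](cardC1 r) -sum_nat_const.
apply: eq_big => [x|x xr]; first by rewrite !inE.
rewrite !draws -!big_split -card_draws -sum1dep_card; apply: eq_bigr => S /eqP cS.
rewrite !inE xr /=.
rewrite -disjoints_subset -setI_eq0; case: eqP => E0; case: (boolP (S \subset _)) => //.
by move/setIidPl=> E; move: cS; rewrite -E E0 cards0 => E'; rewrite -E' in k0.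
Qed.

(* The number of [k]-sets of vertices not split by an edge of a tree of order [n]
   that leaves [a] vertices on one side. *)
Definition nonsplit (n k a : nat) : nat := 'C(a, k) + 'C(n - a, k).

(** Convexity: raising [m] by one increases ['C(m, k.+1)] by ['C(m, k)], which grows with [m]. *)
Lemma bin_spread k a b t : a <= b -> 'C(a + t, k) + 'C(b, k) <= 'C(a, k) + 'C(b + t, k).
Proof.
case: k => [|k] ab; first by rewrite !bin0.
elim: t => [|t IHt]; first by rewrite !addn0.
rewrite !addnS !binS; have : 'C(a + t, k) <= 'C(b + t, k) by rewrite leq_bin2l // leq_add2r.
lia.
Qed.

Lemma nonsplit_le n k x y : y <= x -> x <= n - y -> y <= n -> nonsplit n k x <= nonsplit n k y.
Proof.
move=> yx xn yn; have := @bin_spread k y (n - x) (x - y); rewrite /nonsplit.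
by rewrite subnKC // (_ : n - x + (x - y) = n - y); [apply; lia | lia].
Qed.

Lemma nonsplitC n k x : x <= n -> nonsplit n k (n - x) = nonsplit n k x.
Proof. by move=> xn; rewrite /nonsplit subKn // addnC. Qed.

Lemma card_ord_range n (A : {set 'I_n}) a b :
  (forall z, z \in A -> a <= z < b) -> #|A| <= b - a.
Proof.
move=> Aab; rewrite cardE -(size_map val) -(size_iota a (b - a)).
apply: uniq_leq_size; first by rewrite map_inj_uniq ?enum_uniq //; apply: val_inj.
by move=> _ /mapP[z zA ->]; rewrite mem_iota; move: zA; rewrite mem_enum => /Aab /=; lia.
Qed.

(** * The caterpillar as a rooted tree *)

Section Caterpillar.

Variables (n d s : nat).

Lemma TC_parent_le y : TC_parent d s y <= y.
Proof. by rewrite /TC_parent uphalf_half; case: (leqP y d) => yd; [|case: ifP => _]; lia. Qed.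

(** The attachment points [d./2] and [uphalf d] differ by [odd d], so these bounds cover both. *)
Lemma TC_parent_pendant y : d < y -> uphalf d <= TC_parent d s y + odd d /\
  TC_parent d s y <= uphalf d.
Proof.
by move=> dy; rewrite /TC_parent (leqNgt y d) dy /= uphalf_half; case: ifP => _; lia.
Qed.

Definition TC_par (x : 'I_n) : 'I_n :=
  Ordinal (leq_ltn_trans (TC_parent_le x) (ltn_ord x)).

(** A pendant vertex is attached to a path vertex, whose depth is its label. *)
Definition TC_depth (x : 'I_n) : nat := if x <= d then x : nat else (TC_par x).+1.

Hypotheses (d_ge2 : 2 <= d) (dn : d < n).

Definition TC_root : 'I_n := Ordinal (leq_ltn_trans (leq0n d) dn).

Definition TC_end : 'I_n := Ordinal dn.

Lemma TC_rooted : rooted (TC n d s) TC_root TC_par TC_depth.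
Proof.
have par_lt (x : 'I_n) : x != TC_root -> TC_par x < x.
  rewrite -val_eqE /= /TC_parent => x0.
  by rewrite uphalf_half; case: (leqP x d) => yd; [|case: ifP => _]; lia.
have edgeE (x y : 'I_n) : (y < x) && (y == TC_parent d s x :> nat)
    = (x != TC_root) && (TC_par x == y).
  rewrite -[TC_par x == y]val_eqE /= eq_sym.
  have [->|xr] := eqVneq x TC_root; first by rewrite ltn0.
  case: eqP => E; last by rewrite !andbF.
  by rewrite andbT -E (par_lt _ xr).
split=> [x y| |x xr] //.
  by rewrite /TC /= !edgeE orbC.
have := par_lt x xr; rewrite /TC_depth /=.
case: (leqP x d) => [xd|dx] lt.
  by rewrite /TC_parent xd in lt *; rewrite ifT; lia.
have [_] := TC_parent_pendant dx; rewrite uphalf_half => le.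
by rewrite ifT //; lia.
Qed.

Lemma TC_depth_end : TC_depth TC_end = d.
Proof. by rewrite /TC_depth /= leqnn. Qed.

Lemma TC_spine i : i <= d -> spine TC_par TC_end d i = i :> nat.
Proof.
rewrite /spine => id; have : d - i <= d by exact: leq_subr.
rewrite -{3}(subKn id); elim: (d - i) => [|j IHj] jd; first by rewrite subn0.
have jd' := ltnW jd; rewrite iterS /= IHj // /TC_parent leq_subr. lia.
Qed.

Lemma TC_spineP (x : 'I_n) :
  (x \in [set spine TC_par TC_end d i | i : 'I_d.+1]) = (x <= d).
Proof.
apply/imsetP/idP => [[i _ ->] | xd].
  by rewrite TC_spine -ltnS ltn_ord.
by exists (inord x) => //; apply/val_inj; rewrite /= inordK // TC_spine.
Qed.

Lemma TC_proj (x : 'I_n) : proj TC_par TC_depth TC_end d x =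
  if x <= d then x : nat else TC_parent d s x.
Proof.
have le_d (y : 'I_n) : y <= d -> proj TC_par TC_depth TC_end d y = y.
  move=> yd; have {1}-> : y = spine TC_par TC_end d y by apply/val_inj; rewrite /= TC_spine.
  by rewrite (proj_spine TC_rooted TC_depth_end).
case: leqP => [|dx]; first exact: le_d.
rewrite (proj_par TC_rooted TC_depth_end) ?TC_spineP -?ltnNge // le_d //=.
by have [_] := TC_parent_pendant dx; rewrite uphalf_half; lia.
Qed.

Lemma TC_off_spine S : off_spine TC_par TC_end d S = [set x in S | d < x].
Proof. by apply/setP => x; rewrite !inE TC_spineP andbC ltnNge. Qed.

Lemma TC_desc_pendant (x : 'I_n) : d < x -> desc TC_par TC_depth x = [set x].
Proof.
move=> dx; apply/setP => y; rewrite inE; apply/idP/eqP => [|->]; last exact: (desc_refl TC_rooted).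
have [m] := ubnP (TC_depth y); elim: m y => // m IH y.
rewrite (descE TC_rooted); have [//|yx] := eqVneq y x.
have [//|yr /=] := eqVneq y TC_root.
have [_ _ /(_ y yr) ->] := TC_rooted; rewrite ltnS => my /(IH _ my) E.
exfalso; move: (congr1 val E) dx => /= <-; have := TC_parent_le y.
case: (leqP y d) => [|dy]; first lia.
by have [_] := TC_parent_pendant dy; rewrite uphalf_half; lia.
Qed.

Lemma TC_steiner_le (S : {set 'I_n}) a b : S != set0 ->
  (forall x, x \in S -> a <= proj TC_par TC_depth TC_end d x <= b) ->
  steiner (TC n d s) S <= (b - a) + #|[set x in S | d < x]|.
Proof.
move=> S0 Sab; apply: leq_trans (steiner_le_sepset TC_rooted S0) _.
rewrite -TC_off_spine; apply: (card_sepset_le TC_rooted TC_depth_end) => // v.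
by rewrite TC_spineP -ltnNge => /TC_desc_pendant.
Qed.

(** Here [a] is meant as the number of descendants of the corresponding vertex of the other tree. As
    the pendant vertices hang at the middle, a path edge of the caterpillar has one side made of
    path vertices only, and no more of them than on the other side; the bounds on [a] make it at
    least as balanced. The middle edge of an odd path needs the hypothesis on [s]. *)
Lemma TC_nonsplit_ge k a (x : 'I_n) :
  (odd d -> k <= n - uphalf d -> s = 0 \/ s = n - d - 1) ->
  x != TC_root -> 0 < a < n -> (x <= d -> d - x < a /\ x <= n - a) ->
  nonsplit n k a <= nonsplit n k #|desc TC_par TC_depth x|.
Proof.
move=> sP x0 an xa; set D := desc _ _ _.
have Dn : #|D| <= n by rewrite -[leqRHS]card_ord max_card.
have DC : #|~: D| = n - #|D| by rewrite cardsCs setCK card_ord.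
case: (leqP x d) => [xd|dx]; last first.
  by rewrite /D TC_desc_pendant // cards1 nonsplit_le //; lia.
have [xa1 xa2] := xa xd.
have mem (z : 'I_n) : (z \in D) = (x <= if z <= d then z : nat else TC_parent d s z).
  rewrite -TC_proj (le_proj TC_rooted TC_depth_end) // /D.
  by congr (_ \in desc _ _ _); apply/val_inj; rewrite /= TC_spine.
(* The side free of pendant vertices is the lower one here and the upper one in [smallC]. *)
have smallD : (forall z : 'I_n, d < z -> TC_parent d s z < x) -> d.+1 - x <= x ->
    nonsplit n k a <= nonsplit n k #|D|.
  move=> far xx; have cD : #|D| <= d.+1 - x.
    apply: card_ord_range => z; rewrite mem; case: (leqP z d) => [|/far]; lia.
  by apply: nonsplit_le; lia.
have smallC : (forall z : 'I_n, d < z -> x <= TC_parent d s z) -> x <= d.+1 - x ->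
    nonsplit n k a <= nonsplit n k #|D|.
  move=> near xx; have cD : #|~: D| <= x - 0.
    apply: card_ord_range => z; rewrite in_setC mem; case: (leqP z d) => [|/near]; lia.
  by rewrite -[leqRHS]nonsplitC // -DC; apply: nonsplit_le; lia.
have dE := odd_double_half d; rewrite -muln2 in dE.
have uE := uphalf_half d.
case: (ltngtP x (uphalf d)) => [lt|gt|eq].
- by apply: smallC => [z /TC_parent_pendant|]; lia.
- by apply: smallD => [z /TC_parent_pendant|]; lia.
case: (boolP (odd d)) => od; last first.
  rewrite (negPf od) !add0n in dE uE.
  apply: smallC => [z /TC_parent_pendant|]; rewrite ?(negPf od) ?addn0.
    by case; lia.
  by lia.
(* This is the middle edge of an odd path. If [k > n - uphalf d], both [a] and [n - a] are below
   [k], so no [k]-set is left unsplit; otherwise [sP] puts all pendant vertices on one side. *)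
rewrite od /= in dE uE; case: (leqP k (n - uphalf d)) => kn; last first.
  by have -> : nonsplit n k a = 0; rewrite // /nonsplit !bin_small //; lia.
case: (sP od kn) => sE.
  by apply: smallC => [z dz|]; [rewrite /TC_parent (leqNgt z d) dz sE addn0 (leqNgt z d) dz /=|]; lia.
apply: smallD => [z dz|]; last by lia.
by have zn := ltn_ord z; rewrite /TC_parent (leqNgt z d) dz sE /= ifT; lia.
Qed.

End Caterpillar.

(** * Comparison of a tree with the caterpillar *)

Section Comparison.

Variables (V : finType) (e : rel V) (r : V) (par : V -> V) (h : V -> nat).
Hypothesis tr : rooted e r par h.
Variables (t : V) (n d s : nat).
Hypotheses (ht : h t = d) (cardV : #|V| = n) (d_ge2 : 2 <= d) (dn : d < n).

(** List the spine first, then all other vertices in arbitrary order. *)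
Lemma labelling : exists2 phi : 'I_n -> V,
  injective phi & forall i : 'I_n, i <= d -> phi i = spine par t d i.
Proof.
pose P := [seq spine par t d i | i <- iota 0 d.+1].
pose us := P ++ [seq v <- enum V | v \notin P].
have uP : uniq P.
  rewrite map_inj_in_uniq ?iota_uniq // => i j; rewrite !mem_iota !add0n !ltnS => id jd.
  exact: (spine_inj tr ht).
have uus : uniq us.
  rewrite cat_uniq uP filter_uniq ?enum_uniq // andbT /=.
  by apply/hasPn => v; rewrite mem_filter => /andP[].
have sus : size us = n.
  rewrite -(card_uniqP uus) -cardV; apply: eq_card => v.
  by rewrite mem_cat mem_filter mem_enum; case: (v \in P).
exists (fun i : 'I_n => nth r us i) => [i j /eqP|i id].
  by rewrite nth_uniq ?sus // => /eqP/ord_inj.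
by rewrite nth_cat size_map size_iota ltnS id (nth_map 0) ?size_iota // nth_iota.
Qed.

Variable phi : 'I_n -> V.
Hypotheses (phi_inj : injective phi)
  (phi_spine : forall i : 'I_n, i <= d -> phi i = spine par t d i).

Lemma phi_spineP x : (phi x \in [set spine par t d i | i : 'I_d.+1]) = (x <= d).
Proof.
apply/imsetP/idP => [[i _ E]|xd]; last first.
  by exists (inord x) => //; rewrite inordK // phi_spine.
have id : i <= d by rewrite -ltnS.
suff -> : x = Ordinal (leq_ltn_trans id dn) by [].
by apply: phi_inj; rewrite E phi_spine.
Qed.

Lemma phi_bij : bijective phi.
Proof. by apply: inj_card_bij phi_inj _; rewrite card_ord cardV. Qed.

Lemma steiner_phi_ge (S : {set 'I_n}) x y p : x \in S -> y \in S -> p \in S -> p <= d ->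
  (proj par h t d (phi x) - proj par h t d (phi y)) + #|[set z in S | d < z]|
    <= steiner e (phi @: S).
Proof.
move=> xS yS pS pd; apply: leq_trans (sepset_le_steiner tr _).
have := card_sepset_ge tr ht (imset_f phi xS) (imset_f phi yS) pd.
rewrite -phi_spine // imset_f // => /(_ isT).
suff -> : off_spine par t d (phi @: S) = phi @: [set z in S | d < z] by rewrite card_imset.
apply/setP=> v; rewrite inE; apply/andP/imsetP => [[vP /imsetP[z zS E]]|[z + ->]].
  by exists z => //; rewrite inE zS ltnNge -phi_spineP -E.
by rewrite inE => /andP[zS dz]; rewrite phi_spineP -ltnNge dz imset_f.
Qed.

Local Notation projC := (proj (@TC_par n d s) (@TC_depth n d s) (TC_end dn) d).
Local Notation projT z := (proj par h t d (phi z)).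

Lemma projC_pendant (z : 'I_n) : d < z ->
  [/\ 0 < projC z, projC z < d, projC z <= uphalf d & d - projC z <= uphalf d].
Proof.
move=> dz; rewrite TC_proj // (leqNgt z d) dz /=.
have [] := TC_parent_pendant s dz; rewrite uphalf_half.
have := odd_double_half d; rewrite -muln2; case: (odd d); split; lia.
Qed.

Lemma projT_spine (z : 'I_n) : z <= d -> projT z = z.
Proof. by move=> zd; rewrite phi_spine // (proj_spine tr ht). Qed.

Lemma projC_spine (z : 'I_n) : z <= d -> projC z = z.
Proof. by move=> zd; rewrite TC_proj // zd. Qed.

(** If both path ends are in [R], the span is already [d] and [y = x] works. Otherwise [y] is an end
    outside [R], which stretches the span in the tree enough to make up for losing a possibly
    pendant [x]. *)
Lemma exchange_vertex (R : {set 'I_n}) x : R != set0 -> x \notin R ->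
  exists2 y, y \notin R & steiner (TC n d s) (x |: R) <= steiner e (phi @: (y |: R)).
Proof.
move=> R0 xR; set o := Ordinal (leq_ltn_trans (leq0n d) dn).
pose m := Ordinal dn.
have o_d : o <= d by []. have m_d : m <= d by exact: leqnn.
have projCd z : projC z <= d by apply: proj_le.
have off y : #|[set z in y |: R | d < z]| = (y \notin R) * (d < y) + #|[set z in R | d < z]|.
  have [yd|dy] := leqP y d.
    rewrite muln0; apply: eq_card => z; rewrite !inE.
    by case: eqP => //= ->; rewrite ltnNge yd andbF.
  have -> : [set z in y |: R | d < z] = y |: [set z in R | d < z].
    by apply/setP => z; rewrite !inE; case: eqP => //= ->.
  by rewrite cardsU1 inE dy andbT muln1.
have lowT y z w p : z \in y |: R -> w \in y |: R -> p \in y |: R -> p <= d ->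
    projT z - projT w + #|[set z in y |: R | d < z]| <= steiner e (phi @: (y |: R)).
  exact: steiner_phi_ge.
have [/andP[oR mR]|ends] := boolP ((o \in R) && (m \in R)).
  exists x => //; apply: leq_trans (lowT x m o o _ _ _ o_d); rewrite ?inE ?oR ?mR ?orbT //.
  rewrite !projT_spine //=; apply: TC_steiner_le => // [|z _]; last by rewrite projCd.
  by apply/set0Pn; exists x; rewrite setU11.
(* If one end is in [R], adding the other gives span [d]. If neither is, adding an end gives span at
   least [projT z] or [d - projT z]. The larger of these is at least [c]: for [z] on the spine, [c]
   is one of them; for other [z], the larger is at least [uphalf d]. *)
have reach c z : z \in R -> c <= d -> (z <= d -> c = z \/ c = d - z) ->
    (d < z -> c <= uphalf d) ->
    exists2 y, y \notin R & c + #|[set z in R | d < z]| <= steiner e (phi @: (y |: R)).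
  move=> zR cd zP zQ.
  have yo := lowT o _ _ o _ _ (setU11 _ _) o_d.
  have ym := lowT m _ _ m _ _ (setU11 _ _) m_d.
  have offs (y : 'I_n) : y <= d -> #|[set z in y |: R | d < z]| = #|[set z in R | d < z]|.
    by move=> yd; rewrite off ltnNge yd muln0.
  rewrite offs // in yo; rewrite offs // in ym.
  have o0 : projT o = 0 by rewrite projT_spine.
  have md : projT m = d by rewrite projT_spine.
  have [oR|oR] := boolP (o \in R).
    have mR : m \notin R by rewrite oR in ends.
    exists m => //; apply: leq_trans (ym m o _ _); rewrite ?setU11 ?inE ?oR ?orbT //.
    by rewrite o0 md; lia.
  have [mR|mR] := boolP (m \in R).
    exists o => //; apply: leq_trans (yo m o _ _); rewrite ?setU11 ?inE ?mR ?orbT //.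
    by rewrite o0 md; lia.
  have [cz|zc] := leqP c (projT z).
    exists o => //; apply: leq_trans (yo z o _ _); rewrite ?setU11 ?inE ?zR ?orbT //.
    by rewrite o0; lia.
  exists m => //; apply: leq_trans (ym m z _ _); rewrite ?setU11 ?inE ?zR ?orbT //.
  rewrite md leq_add2r; have [zd|dz] := leqP z d.
    by have := zP zd; rewrite (projT_spine zd) in zc *; lia.
  by have := zQ dz; have := uphalf_half d; have := odd_double_half d; rewrite -muln2; lia.
case/set0Pn: R0 => z0 z0R.
case: (arg_minnP (fun z => projC z) z0R) => zl zlR lmin.
case: (arg_maxnP (fun z => projC z) z0R) => zh zhR hmax.
set a := projC zl in lmin; set b := projC zh in hmax.
have ad : a <= d by apply: projCd.
have bd : b <= d by apply: projCd.
have ab : a <= b by apply: lmin.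
(* Pendant vertices project to inner path vertices, so projections [0] and [d] can only come from
   the ends themselves. *)
have not_ends : ~ (a = 0 /\ b = d).
  move=> [a0 bE]; case/negP: ends; apply/andP; split.
    suff <- : zl = o by [].
    have [zd|/projC_pendant[]] := leqP zl d; last by rewrite -/a a0.
    by apply: ord_inj; rewrite /= -a0 /a projC_spine.
  suff <- : zh = m by [].
  have [zd|/projC_pendant[]] := leqP zh d; last by rewrite -/b bE ltnn.
  by apply: ord_inj; rewrite /= -bE /b projC_spine.
(* In the caterpillar, adding the end [0] to [R] gives span [b] and adding [d] gives span [d - a];
   the tree does at least as well as the better choice. *)
have [y yR ley] : exists2 y, y \notin R &
    maxn b (d - a) + #|[set z in R | d < z]| <= steiner e (phi @: (y |: R)).
  rewrite /maxn; case: ifP => _; [apply: (reach _ zl) | apply: (reach _ zh)] => //.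
  - exact: leq_subr.
  - by move=> zd; rewrite /a projC_spine //; right.
  - by move=> /projC_pendant[].
  - by move=> zd; rewrite /b projC_spine //; left.
  - by move=> /projC_pendant[].
exists y => //; apply: leq_trans ley.
apply: (@leq_trans ((maxn b (projC x) - minn a (projC x)) + #|[set z in x |: R | d < z]|)).
  apply: TC_steiner_le => // [|z]; first by apply/set0Pn; exists x; rewrite setU11.
  rewrite !inE leq_max geq_min => /predU1P[->|zR]; first by rewrite !leqnn !orbT.
  by rewrite [a <= _]lmin // [_ <= b]hmax.
rewrite off xR mul1n addnA leq_add2r.
(* A path vertex [x] gives span at most [maxn b (d - a)]. A pendant one adds one more edge, but its
   projection is an inner vertex and [a > 0] or [b < d] by [not_ends], so one unit of span is to
   spare. *)
have [xd|dx] := leqP x d; first by rewrite (projC_spine xd); lia.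
by have [] := projC_pendant dx; lia.
Qed.

(** A [k]-set containing [S] has a vertex outside [S]; exchanging it keeps [S] inside, and [k >= 2]
    leaves a nonempty rest. *)
Lemma ecc_le_pointwise k (S : {set 'I_n}) : 2 <= k -> #|S| < k ->
  ecc (TC n d s) k S <= ecc e k (phi @: S).
Proof.
move=> k2 Sk; apply/bigmax_leqP => S' /andP[SS' /eqP S'k].
have /subsetPn[x xS' xS] : ~~ (S' \subset S).
  by apply/negP => /subset_leq_card; rewrite S'k leqNgt Sk.
have cR : #|S' :\ x| = k.-1 by rewrite -S'k (cardsD1 x S') xS'.
have [||y yR le] := @exchange_vertex (S' :\ x) x.
- by rewrite -card_gt0 cR; lia.
- by rewrite !inE eqxx.
rewrite -{1}(setD1K xS'); apply: leq_trans le _; apply: leq_bigmax_cond; apply/andP; split.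
  apply: imsetS; apply/subsetP => z zS; rewrite in_setU in_setD1 (subsetP SS' z zS) andbT.
  by apply/orP; right; apply: contraNneq xS => <-.
by rewrite card_imset // cardsU1 yR cR; apply/eqP; lia.
Qed.

Lemma ecc_full (W : finType) (f : rel W) k (S : {set W}) : #|S| = k -> ecc f k S = steiner f S.
Proof.
move=> Sk; rewrite /ecc (big_pred1 S) // => S' /=.
apply/andP/eqP => [[SS' /eqP S'k]|->]; last by rewrite subxx Sk eqxx.
by apply/esym/eqP; rewrite eqEcard SS' S'k Sk leqnn.
Qed.

Lemma sum_steiner_le k : 0 < k ->
  (odd d -> k <= n - uphalf d -> s = 0 \/ s = n - d - 1) ->
  \sum_(S : {set 'I_n} | #|S| == k) steiner (TC n d s) S
  <= \sum_(S : {set V} | #|S| == k) steiner e S.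
Proof.
move=> k0 sP.
have trC := @TC_rooted n d s d_ge2 dn.
apply: (@leq_trans (\sum_(S : {set V} | #|S| == k) #|sepset r par h S|)); last first.
  by apply: leq_sum => S _; apply: (sepset_le_steiner tr).
apply: (@leq_trans (\sum_(S : {set 'I_n} | #|S| == k)
    #|sepset (TC_root dn) (@TC_par n d s) (@TC_depth n d s) S|)).
  apply: leq_sum => S /eqP Sk; apply: (steiner_le_sepset trC).
  by rewrite -card_gt0 Sk.
have := sum_sepset r par h k0.
have := sum_sepset (TC_root dn) (@TC_par n d s) (@TC_depth n d s) k0.
rewrite card_ord cardV => <- sumT.
(* Split and unsplit pairs add up to the same total in both trees, so the inequality reverses. *)
suff : \sum_(x | x != r) ('C(#|desc par h x|, k) + 'C(#|~: desc par h x|, k))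
  <= \sum_(x | x != TC_root dn) ('C(#|desc (@TC_par n d s) (@TC_depth n d s) x|, k)
     + 'C(#|~: desc (@TC_par n d s) (@TC_depth n d s) x|, k)).
  by rewrite -(leq_add2l (\sum_(S : {set V} | #|S| == k) #|sepset r par h S|)) sumT leq_add2r.
have rE : r = phi (TC_root dn) by rewrite phi_spine // (spine0 tr ht).
(* Edges are matched through their lower endpoints. The arbitrary labels off the spine do no harm,
   as pendant edges are the least balanced of all. *)
rewrite (reindex phi) /=; last exact/onW_bij/phi_bij.
rewrite (eq_bigl (fun x => x != TC_root dn)); last by move=> x; rewrite rE (inj_eq phi_inj).
apply: leq_sum => x x0.
have nonsplitE (W : finType) (D : {set W}) : #|W| = n ->
    'C(#|D|, k) + 'C(#|~: D|, k) = nonsplit n k #|D|.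
  by move=> Wn; rewrite /nonsplit (cardsCs (~: D)) setCK Wn.
rewrite !nonsplitE ?card_ord //; apply: TC_nonsplit_ge => //.
  have xr : phi x != r by rewrite rE (inj_eq phi_inj).
  rewrite -cardV -cardsT; apply/andP; split.
    by apply/card_gt0P; exists (phi x); apply: (desc_refl tr).
  apply: proper_card; rewrite properE subsetT /=; apply/subsetPn; exists r; rewrite ?inE //.
  by case: tr => _ hr _; rewrite hr sub0n /= eq_sym (negPf xr) andbF.
move=> xd; rewrite phi_spine //; split; first exact: (card_desc_spine_ge tr ht).
have := card_desc_spineC_ge tr ht xd.
by rewrite (cardsCs (~: _)) setCK cardV.
Qed.

Lemma sum_ecc_le k l : 2 <= k -> l <= k ->
  (odd d -> l = k -> k <= n - uphalf d -> s = 0 \/ s = n - d - 1) ->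
  \sum_(S : {set 'I_n} | #|S| == l) ecc (TC n d s) k S
  <= \sum_(S : {set V} | #|S| == l) ecc e k S.
Proof.
move=> k2 lk sP; case: (ltngtP l k) lk => // [lk _|Elk _].
  have [phi' phiK phi'K] := phi_bij.
  have imK (A B : finType) (f : A -> B) g : cancel f g -> cancel (fun S : {set A} => f @: S)
      (fun S : {set B} => g @: S).
    by move=> fK S; rewrite -imset_comp -[RHS]imset_id; apply: eq_imset.
  rewrite [leqRHS](reindex (fun S : {set 'I_n} => phi @: S)); last first.
    by apply: onW_bij; exists (fun S : {set V} => phi' @: S); apply: imK.
  under [leqRHS]eq_bigl => S do rewrite card_imset //.
  by apply: leq_sum => S /eqP Sl; apply: ecc_le_pointwise => //; rewrite Sl.
rewrite Elk in sP *.
under eq_bigr => S /eqP Sk do rewrite ecc_full //.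
under [leqRHS]eq_bigr => S /eqP Sk do rewrite ecc_full //.
by apply: sum_steiner_le => [|od]; [lia | apply: sP].
Qed.

End Comparison.

Theorem theorem9 (V : finType) (e : rel V) (n d k l s : nat)
  (treeT : is_tree e) (orderT : #|V| = n)
  (diamT : diameter e = d) (d_ge2 : 2 <= d)
  (k_ge2 : 2 <= k) (l_le_k : l <= k) (k_le_n : k <= n)
  (s_le : s <= n - d - 1)
  (s_extreme : odd d -> l = k -> k <= n - uphalf d ->
               s = 0 \/ s = n - d - 1) :
  (avg_ecc (TC n d s) k l <= avg_ecc e k l)%R.
Proof.
have V0 : 0 < #|V| by lia.
(* Rooted at an end [r] of a diametral path, the tree has depth function [dist e r], and its spine
   from [r] to [t] is such a path. *)
have [r [t ht]] := diameter_attained e V0; rewrite diamT in ht.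
have [par tr] := tree_rooted r treeT.
have dn : d < n.
  rewrite -orderT -[leqLHS](@spine_segment_card _ _ _ _ _ tr _ _ ht 0 d.+1) //.
  exact: max_card.
have [phi phi_inj phi_spine] := labelling tr ht orderT.
rewrite /avg_ecc card_ord orderT Num.Theory.ler_wpM2l //.
  by rewrite Num.Theory.invr_ge0 Num.Theory.ler0n.
by rewrite Num.Theory.ler_nat (sum_ecc_le tr ht orderT d_ge2 dn phi_inj phi_spine).
Qed.
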